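(* Let $(M,\mathrm{dist})$ be a compact metric space and let $f:M\to M$ be a topologically transitive homeomorphism satisfying both the Anosov closing property and the periodic exponential specification property. Let $d\ge1$, $\alpha>0$, and let $A:M\to M(d,\mathbb{R})$ be an $\alpha$-Hölder continuous map. Assume that $$A(f^{n-1}(p))\cdots A(f(p))A(p)=\mathrm{Id}\quad\text{for every } n\in\mathbb{N},\ n\ge1,\text{ and every } p\in M \text{ with } f^n(p)=p.$$ Then there exists an $\alpha$-Hölder continuous map $P:M\to GL(d,\mathbb{R})$ such that $$A(x)=P(f(x))P(x)^{-1}\quad\text{for every } x\in M.$$
   Context: $M(d,\mathbb{R})$ denotes the space of real $d\times d$ matrices, with the operator norm $\|\cdot\|$; the matrices $A(x)$ are not assumed invertible. $A$ is $\alpha$-Hölder continuous if there is $C_1>0$ with $\|A(x)-A(y)\|\le C_1\,\mathrm{dist}(x,y)^{\alpha}$ for all $x,y\in M$. On $GL(d,\mathbb{R})$ one uses the distance $\tilde d(B,B')=\|B-B'\|+\|B^{-1}-B'^{-1}\|$. Periodic exponential specification property: there exists $\theta>0$ such that for every $\delta>0$ there exists a positive integer $S=S(\delta)$ such that for every $x\in M$ and every $n\in\mathbb{N}$ there exists $p\in M$ with $f^{n+S}(p)=p$ and $\mathrm{dist}(f^j(p),f^j(x))<\delta e^{-\theta\min\{j,\,n-j\}}$ for all $j=0,1,\ldots,n$. Anosov closing property: there exist $C_2,\varepsilon_0,\theta>0$ such that whenever $z\in M$ and $n\in\mathbb{N}$ satisfy $\mathrm{dist}(f^n(z),z)<\varepsilon_0$,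 there exist a point $p\in M$ with $f^n(p)=p$ and $$\mathrm{dist}(f^j(z),f^j(p))\le C_2e^{-\theta\min\{j,\,n-j\}}\,\mathrm{dist}(f^n(z),z)\quad\text{for } j=0,1,\ldots,n,$$ and a point $y\in M$ with $$\mathrm{dist}(f^j(y),f^j(p))\le C_2e^{-\theta j}\,\mathrm{dist}(f^n(z),z)\quad\text{and}\quad \mathrm{dist}(f^j(z),f^j(y))\le C_2e^{-\theta(n-j)}\,\mathrm{dist}(f^n(z),z)$$ for $j=0,1,\ldots,n$. (The constants $\theta$ in the two properties need not coincide.) *)

(* Defs.v *)
From mathcomp Require Import all_boot all_order all_algebra.
From mathcomp Require Import all_classical all_reals all_analysis.

Set Implicit Arguments.
Unset Strict Implicit.
Unset Printing Implicit Defensive.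

Import Order.TTheory GRing.Theory Num.Theory.
Import numFieldNormedType.Exports.

Local Open Scope classical_set_scope.
Local Open Scope ring_scope.

Definition homeomorphism (M : topologicalType) (f : M -> M) : Prop :=
  exists g : M -> M,
    [/\ cancel f g, cancel g f, continuous f & continuous g].

Definition topologically_transitive (M : topologicalType) (f : M -> M) : Prop :=
  forall U V : set M, open U -> open V -> U !=set0 -> V !=set0 ->
    exists n : nat, (iter n f @` U) `&` V !=set0.

Definition periodic_exponential_specification (R : realType) (M : metricType R)
    (f : M -> M) : Prop :=
  exists theta : R, 0 < theta /\
  forall delta : R, 0 < delta ->
  exists S : nat, (0 < S)%N /\
  forall (x : M) (n : nat), exists p : M,
    iter (n + S) f p = p /\
    forall j : nat, (j <= n)%N ->
      mdist (iter j f p) (iter j f x)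
        < delta * expR (- (theta * (minn j (n - j))%:R)).

Definition anosov_closing (R : realType) (M : metricType R) (f : M -> M) : Prop :=
  exists C2 eps0 theta : R, [/\ 0 < C2, 0 < eps0, 0 < theta &
  forall (z : M) (n : nat), mdist (iter n f z) z < eps0 ->
  exists p : M, [/\ iter n f p = p,
    forall j : nat, (j <= n)%N ->
      mdist (iter j f z) (iter j f p)
        <= C2 * expR (- (theta * (minn j (n - j))%:R)) * mdist (iter n f z) z &
    exists y : M, forall j : nat, (j <= n)%N ->
      mdist (iter j f y) (iter j f p)
        <= C2 * expR (- (theta * j%:R)) * mdist (iter n f z) z /\
      mdist (iter j f z) (iter j f y)
        <= C2 * expR (- (theta * (n - j)%:R)) * mdist (iter n f z) z]].

(* The library norm on 'cV[R]_d and 'M[R]_d is the sup norm on entries, hence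
   the explicit Euclidean and operator norms. *)
Definition enorm (R : realType) (d : nat) (v : 'cV[R]_d) : R :=
  Num.sqrt (\sum_(i < d) v i 0 ^+ 2).

Definition opnorm (R : realType) (d : nat) (B : 'M[R]_d) : R :=
  sup [set enorm (B *m v) | v in [set v : 'cV[R]_d | enorm v <= 1]].

Definition gldist (R : realType) (d : nat) (B B' : 'M[R]_d) : R :=
  opnorm (B - B') + opnorm (invmx B - invmx B').

Definition hoelder_map (R : realType) (M : metricType R) (T : Type)
    (dT : T -> T -> R) (alpha : R) (F : M -> T) : Prop :=
  exists C : R, 0 < C /\
    forall x y : M, dT (F x) (F y) <= C * mdist x y `^ alpha.

(* A(f^(n-1) x) ... A(f x) A(x), with the empty product equal to the identity. *)
Fixpoint cocycle (R : realType) (M : Type) (d : nat) (f : M -> M)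
    (A : M -> 'M[R]_d) (n : nat) (x : M) : 'M[R]_d :=
  if n is m.+1 then A (iter m f x) *m cocycle f A m x else 1%:M.

(* Main.v *)
Require Import Defs.
From mathcomp Require Import all_boot all_order all_algebra.
From mathcomp Require Import all_classical all_reals all_analysis.
From mathcomp Require Import ring lra zify.

(** The hypothesis of trivial periodic data is propagated to the whole space by
    shadowing, after the growth of the cocycle has been controlled.

    Since [A] may be singular, the first step is to show that the scalar cocycle
    [a = det A], which has trivial periodic data, does not vanish. If the products of
    [a] grew along long orbit segments, most times of such a segment would be followed
    and preceded only by factors that are not too small; two such times at which the
    segment nearly returns can be closed up, and the product over the closed orbit,
    which is 1, is comparable to the product over the segment. Covering the segment by
    boundedly many such returns bounds its product, so products of [a] grow
    subexponentially. A zero of [a] could then be shadowed by the middle of a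
    periodic orbit, making a small factor that the others cannot compensate.

    Now [A] is uniformly invertible, and a periodic orbit of length [n + S] shadowing
    [n] iterates of [x] gives A^n(p) = (A^S(f^n p))^-1, bounded in terms of [S] only.
    If A^m(x) has growth rate at most [mu + theta alpha / 2], the two estimates available
    for the factors in the telescoping sum for A^n(x) - A^n(p) differ by
    exp(theta alpha / 2 * min(i, n - i)), which the exponential shadowing absorbs; hence
    the rate is at most [mu], and descending to 0 the cocycle and its inverses are
    bounded. The closing property then makes A^n(z) Hoelder-close to the identity
    along near returns, and the transfer map is obtained as a limit of A^n over nearly
    dense orbits. *)

Set Implicit Arguments.
Unset Strict Implicit.
Unset Printing Implicit Defensive.

Import Order.TTheory GRing.Theory Num.Theory.
Import numFieldNormedType.Exports.

Local Open Scope classical_set_scope.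
Local Open Scope ring_scope.

(** * The entrywise sum norm: submultiplicative, and equivalent to the operator norm *)

Definition mnorm (R : realType) (m n : nat) (B : 'M[R]_(m, n)) : R :=
  \sum_(i < m) \sum_(j < n) `|B i j|.

Section MatrixNorm.
Variable R : realType.

Lemma mnorm_ge0 m n (B : 'M[R]_(m, n)) : 0 <= mnorm B.
Proof. by apply: sumr_ge0 => i _; apply: sumr_ge0. Qed.

Lemma mnorm_entry m n (B : 'M[R]_(m, n)) i j : `|B i j| <= mnorm B.
Proof.
rewrite /mnorm (bigD1 i)//= (bigD1 j)//= -addrA lerDl.
by rewrite addr_ge0//; do ?[apply: sumr_ge0 => ? _].
Qed.

Lemma mnorm0 m n : mnorm (0 : 'M[R]_(m, n)) = 0.
Proof. by apply: big1 => i _; apply: big1 => j _; rewrite mxE normr0. Qed.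

Lemma mnorm_le0 m n (B : 'M[R]_(m, n)) : mnorm B <= 0 -> B = 0.
Proof.
move=> B0; apply/matrixP => i j; rewrite mxE; apply/eqP.
by rewrite -normr_le0 (le_trans (mnorm_entry _ _ _)).
Qed.

Lemma ler_mnormD m n (B C : 'M[R]_(m, n)) : mnorm (B + C) <= mnorm B + mnorm C.
Proof.
rewrite /mnorm -big_split/=; apply: ler_sum => i _.
rewrite -big_split/=; apply: ler_sum => j _.
by rewrite mxE ler_normD.
Qed.

Lemma mnormN m n (B : 'M[R]_(m, n)) : mnorm (- B) = mnorm B.
Proof. by apply: eq_bigr => i _; apply: eq_bigr => j _; rewrite mxE normrN. Qed.

Lemma mnormB m n (B C : 'M[R]_(m, n)) : mnorm (B - C) = mnorm (C - B).
Proof. by rewrite -mnormN opprB. Qed.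

Lemma ler_mnormB m n (B C : 'M[R]_(m, n)) : mnorm (B - C) <= mnorm B + mnorm C.
Proof. by rewrite (le_trans (ler_mnormD _ _))// mnormN. Qed.

Lemma mnorm_triangle m n (X B C : 'M[R]_(m, n)) :
  mnorm (B - C) <= mnorm (B - X) + mnorm (X - C).
Proof. by rewrite (le_trans _ (ler_mnormD _ _))// addrA subrK. Qed.

Lemma ler_mnormM m n p (B : 'M[R]_(m, n)) (C : 'M[R]_(n, p)) :
  mnorm (B *m C) <= mnorm B * mnorm C.
Proof.
rewrite /mnorm mulr_suml; apply: ler_sum => i _.
apply: (@le_trans _ _ (\sum_j \sum_k `|B i k| * `|C k j|)).
  apply: ler_sum => j _; rewrite mxE (le_trans (ler_norm_sum _ _ _))//.
  by apply: ler_sum => k _; rewrite normrM.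
rewrite exchange_big/= mulr_suml; apply: ler_sum => k _.
rewrite -mulr_sumr ler_wpM2l//.
rewrite [leRHS](bigD1 k)//= lerDl; apply: sumr_ge0 => l _.
exact: sumr_ge0.
Qed.

Lemma mnorm1 n : mnorm (1%:M : 'M[R]_n) = n%:R.
Proof.
rewrite /mnorm -[in RHS](card_ord n) -sumr_const; apply: eq_bigr => i _.
rewrite (bigD1 i)//= mxE eqxx normr1 big1 ?addr0// => j ji.
by rewrite mxE eq_sym (negbTE ji) normr0.
Qed.

Lemma ler_mnorm_mx m n (B : 'M[R]_(m, n)) b :
  (forall i j, `|B i j| <= b) -> mnorm B <= b *+ (m * n).
Proof.
move=> Bb; apply: (@le_trans _ _ (\sum_(i < m) \sum_(j < n) b)).
  by apply: ler_sum => i _; apply: ler_sum.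
by under eq_bigr do rewrite sumr_const card_ord; rewrite sumr_const card_ord mulnC mulrnA.
Qed.

Lemma enorm_ge_entry d (v : 'cV[R]_d) i : `|v i 0| <= enorm v.
Proof.
rewrite -sqrtr_sqr ler_sqrt; last by apply: sumr_ge0 => j _; rewrite sqr_ge0.
by rewrite (bigD1 i)//= lerDl; apply: sumr_ge0 => j _; rewrite sqr_ge0.
Qed.

Lemma enorm_le_sum d (v : 'cV[R]_d) : enorm v <= \sum_i `|v i 0|.
Proof.
have s0 : 0 <= \sum_i `|v i 0| by apply: sumr_ge0.
rewrite -[leRHS]ger0_norm// -sqrtr_sqr ler_sqrt ?sqr_ge0//.
rewrite expr2 mulr_suml; apply: ler_sum => i _.
rewrite -real_normK ?num_real// expr2 ler_wpM2l//.
by rewrite (bigD1 i)//= lerDl; apply: sumr_ge0.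
Qed.

Lemma enorm_mul_le d (B : 'M[R]_d) (v : 'cV[R]_d) :
  enorm v <= 1 -> enorm (B *m v) <= mnorm B.
Proof.
move=> v1; apply: (le_trans (enorm_le_sum _)); apply: ler_sum => i _.
rewrite mxE (le_trans (ler_norm_sum _ _ _))//; apply: ler_sum => j _.
by rewrite normrM ler_piMr// (le_trans (enorm_ge_entry _ _)).
Qed.

Lemma enorm0 d : enorm (0 : 'cV[R]_d) = 0.
Proof. by rewrite /enorm big1 ?sqrtr0// => i _; rewrite mxE expr0n. Qed.

Lemma opnorm_has_sup d (B : 'M[R]_d) :
  has_sup [set enorm (B *m v) | v in [set v : 'cV[R]_d | enorm v <= 1]].
Proof.
split; first by exists (enorm (B *m 0)), 0 => //=; rewrite enorm0.
by exists (mnorm B) => _ [v /= v1 <-]; exact: enorm_mul_le.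
Qed.

Lemma opnorm_le_mnorm d (B : 'M[R]_d) : opnorm B <= mnorm B.
Proof.
apply: ge_sup; first by case: (opnorm_has_sup B).
by move=> _ [v /= v1 <-]; exact: enorm_mul_le.
Qed.

Lemma mnorm_le_opnorm d (B : 'M[R]_d) : mnorm B <= opnorm B *+ (d * d).
Proof.
apply: ler_mnorm_mx => i j.
pose v : 'cV[R]_d := delta_mx j 0.
have v1 : enorm v <= 1.
  rewrite /enorm (bigD1 j)//= mxE !eqxx big1 ?addr0 ?expr1n ?sqrtr1// => k kj.
  by rewrite mxE (negbTE kj) expr0n.
have Bv : (B *m v) i 0 = B i j by rewrite -colE mxE.
rewrite -Bv (le_trans (enorm_ge_entry _ _))//.
by apply: ub_le_sup; [case: (opnorm_has_sup B)|exists v].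
Qed.

(** A row vector [v] killed by [1%:M + E] equals [- v *m E], so its norm is at most half of
    itself. *)
Lemma unitmx_1D n (E : 'M[R]_n) : mnorm E <= 1 / 2 -> 1%:M + E \in unitmx.
Proof.
move=> E2; rewrite -row_free_unit; apply: inj_row_free => v.
rewrite mulmxDr mulmx1 => /eqP; rewrite addr_eq0 => /eqP vE.
apply: mnorm_le0; have := ler_mnormM v E.
have := ler_wpM2l (mnorm_ge0 v) E2.
by rewrite -(mnormN (v *m E)) -vE; lra.
Qed.

(** [Y] factors as [X] times a matrix close to the identity. In the identity [invmx Y = invmx X -
    invmx X *m (Y - X) *m invmx Y] the last term has at most half the norm of [invmx Y] and is
    absorbed on the left. *)
Lemma unitmx_perturb n (X Y : 'M[R]_n) L :
  X \in unitmx -> mnorm (invmx X) <= L -> L * mnorm (Y - X) <= 1 / 2 ->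
  Y \in unitmx /\ mnorm (invmx Y) <= 2 * L.
Proof.
move=> Xu XL YX.
have YE : Y = X *m (1%:M + invmx X *m (Y - X)).
  by rewrite mulmxDr mulmx1 mulmxA mulmxV// mul1mx addrC subrK.
have XYX : mnorm (invmx X *m (Y - X)) <= 1 / 2.
  by rewrite (le_trans (ler_mnormM _ _))// (le_trans _ YX)// ler_wpM2r// mnorm_ge0.
have Yu : Y \in unitmx by rewrite YE unitmx_mul Xu unitmx_1D.
split=> //.
have iYE : invmx Y = invmx X - (invmx X *m (Y - X)) *m invmx Y.
  rewrite -mulmxA mulmxBl mulmxV// mulmxBr mulmx1 mulmxA mulVmx// mul1mx.
  by rewrite opprB addrC subrK.
have := ler_mnormB (invmx X) ((invmx X *m (Y - X)) *m invmx Y).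
rewrite -iYE; have := ler_mnormM (invmx X *m (Y - X)) (invmx Y).
have := ler_wpM2r (mnorm_ge0 (invmx Y)) XYX; lra.
Qed.

End MatrixNorm.

(** * Sums of the exponential weights that come with shadowing *)

Section Exponentials.
Variable R : realType.

Lemma sum_expR_le (k : R) n : 0 < k ->
  \sum_(i < n) expR (- (k * i%:R)) <= (1 - expR (- k))^-1.
Proof.
move=> k0; have q1 : expR (- k) < 1 by rewrite expR_lt1 oppr_lt0.
rewrite (eq_bigr (fun i : 'I_n => expR (- k) ^+ i)) => [|i _]; last first.
  by rewrite -mulNr expRM_natr.
rewrite -[leRHS]mul1r ler_pdivlMr ?subr_gt0// mulrC.
have := subrX1 (expR (- k)) n; have := exprn_ge0 n (expR_ge0 (- k)); lra.
Qed.

Definition shadow_sum (k : R) : R := 2 * (1 - expR (- k))^-1.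

Lemma shadow_sum_ge0 (k : R) : 0 < k -> 0 <= shadow_sum k.
Proof.
by move=> k0; rewrite mulr_ge0// invr_ge0 subr_ge0 ltW// expR_lt1 oppr_lt0.
Qed.

(** Each weight is at most the sum of the weights measured from the two ends, which gives two
    geometric series and a bound independent of [n]. *)
Lemma sum_expR_minn_le (k : R) n : 0 < k ->
  \sum_(i < n) expR (- (k * (minn i (n - i))%:R)) <= shadow_sum k.
Proof.
move=> k0; rewrite /shadow_sum.
apply: (@le_trans _ _ (\sum_(i < n) expR (- (k * i%:R)) +
   \sum_(i < n) expR (- (k * i%:R)))); last first.
  by have := sum_expR_le n k0; lra.
rewrite [X in _ + X](reindex_inj rev_ord_inj)/= -big_split/=.
apply: ler_sum => i _; have [le|le] := leqP i (n - i).
  by rewrite lerDl expR_ge0.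
rewrite -[leLHS]add0r lerD ?expR_ge0// ler_expR lerN2 ler_pM2l// ler_nat; lia.
Qed.

Lemma powR_expR (c t x alpha : R) : 0 <= c ->
  (c * expR (- (t * x))) `^ alpha = c `^ alpha * expR (- (t * alpha * x)).
Proof.
move=> c0; rewrite powRM ?expR_ge0//; congr (_ * _).
by rewrite -expRM; congr expR; ring.
Qed.

End Exponentials.

(** Compactness is applied along the filter of finite lists ordered by inclusion, which yields
    finitely many centres of balls of radius [rho / 2]; the colour of a point is the index of a
    centre near it. Equal colours at two times of an orbit thus mean a near return. *)
Lemma compact_coloring (R : realType) (M : metricType R) (rho : R) :
  compact [set: M] -> 0 < rho ->
  exists (N : nat) (col : M -> 'I_N),
    forall x y, col x = col y -> mdist x y < rho.
Proof.
move=> cM rho0.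
have [l lP] : exists l : seq M, forall x, exists2 c, c \in l & mdist c x < rho / 2.
  have /compact_near_coveringP := cM.
  pose F : set_system (seq M) :=
    filter_from [set: seq M] (fun l => [set l' : seq M | forall x, x \in l -> x \in l']).
  have FF : Filter F.
    apply: filter_from_filter; first by exists [::].
    move=> l1 l2 _ _; exists (l1 ++ l2) => // l /= sl; split => x xl;
      by apply: sl; rewrite mem_cat xl ?orbT.
  move=> /(_ _ F (fun (l : seq M) x => exists2 c, c \in l & mdist c x < rho / 2) FF).
  case.
    move=> x _; exists (ball x (rho / 2), [set l : seq M | x \in l]) => /=.
      split; first by apply: nbhsx_ballx; rewrite divr_gt0.
      by exists [:: x] => // l /(_ x); apply; rewrite inE.
    move=> [y l]/= [xy xl]; exists x => //.
    by rewrite ballEmdist in xy.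
  by move=> l _ /(_ l) /= lP; exists l => x; apply: lP.
have [g gP] := choice (fun x => let: ex_intro2 c cl cx := lP x in
  ex_intro (fun c => c \in l /\ mdist c x < rho / 2) c (conj cl cx)).
have gl x : (index (g x) l < size l)%N by rewrite index_mem; case: (gP x).
exists (size l), (fun x => Ordinal (gl x)) => x y /(congr1 val)/= /index_inj.
move=> /(_ x) gxy; have {}gxy : g x = g y.
  by apply: gxy; case: (gP x); case: (gP y).
have := metric_triangle x (g x) y; rewrite (metric_sym x (g x)).
have [_] := gP x; have [_] := gP y; rewrite -gxy; lra.
Qed.

(** * Combinatorics of sequences whose sums over intervals are bounded above *)

Section RealSequences.
Variable R : realType.
Implicit Types (phi e : nat -> R) (C H D kappa eps : R).

(** Cutting at a time with value below [- C] costs one more additive constant [C] for the extra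
    interval, so the total drops by the excess of that value beyond [- C]. The free length [m] lets
    the induction pass over times without excess. *)
Lemma sum_excess_le phi C kappa N : 0 <= C -> 0 <= kappa ->
  (forall s t, (s <= t <= N)%N ->
    \sum_(s <= j < t) phi j <= kappa * (t - s)%:R + C) ->
  forall n m, (n + m <= N)%N ->
  \sum_(0 <= j < n + m) phi j <=
    kappa * (n + m)%:R + C - \sum_(j < n) Num.max (- phi j - C) 0.
Proof.
move=> C0 k0 bound; elim=> [|n IH] m nmN.
  by rewrite big_ord0 subr0 (le_trans (bound 0%N _ _)) ?subn0//; lia.
rewrite big_ord_recr/=.
have [pC|pC] := leP (- phi n - C) 0.
  by rewrite addr0 addSnnS; apply: IH; lia.
rewrite (big_cat_nat (n := n))/=; [|lia|lia].
rewrite [X in _ + X]big_ltn; last by lia.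
have := IH 0%N; rewrite addn0 => /(_ ltac:(lia)).
have := bound n.+1 (n.+1 + m)%N ltac:(lia).
rewrite addKn addSn -addnS !natrD -(natr1 m) !mulrDr; lra.
Qed.

Lemma count_lt_le (eps e : R) m : 0 < eps -> 0 <= e ->
  \sum_(k < m) (eps * k.+1%:R < e)%R%:R <= e / eps.
Proof.
move=> eps0 e0; elim: m => [|m IH]; first by rewrite big_ord0 divr_ge0// ltW.
rewrite big_ord_recr/=; case: ltP => [lt|_]; last by rewrite addr0.
rewrite ler_pdivlMr//; apply: le_trans (ltW lt).
rewrite mulrC ler_pM2l// -natr1 lerD//.
rewrite -[X in _ <= X%:R](card_ord m) -sumr_const; apply: ler_sum => k _.
by case: ltP.
Qed.

Lemma count_dist_le (eps e : R) j N : 0 < eps -> 0 <= e -> (j < N)%N ->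
  \sum_(s < N) (eps * ((s - j) + (j - s)).+1%:R < e)%R%:R <= 2 * (e / eps).
Proof.
move=> eps0 e0 jN.
rewrite -(big_mkord predT (fun s => (eps * ((s - j) + (j - s)).+1%:R < e)%R%:R)).
rewrite (big_cat_nat (n := j))//=; last by rewrite ltnW.
have -> : forall x : R, 2 * x = x + x by move=> x; lra.
apply: lerD.
  apply: le_trans (count_lt_le j eps0 e0).
  rewrite big_mkord (reindex_inj rev_ord_inj)/=; apply: ler_sum => k _.
  case: ltP => [lt|_]; last by rewrite ler0n.
  rewrite (le_lt_trans _ lt)// ler_pM2l// ler_nat; have := ltn_ord k; lia.
apply: le_trans (count_lt_le (N - j) eps0 e0).
rewrite -{1}(add0n j) big_addn big_mkord; apply: ler_sum => k _.
case: ltP => [lt|_]; last by rewrite ler0n.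
rewrite (le_lt_trans _ lt)// ler_pM2l// ler_nat; lia.
Qed.

(** Greedy covering: a bad time costs [H]; from a good time one jumps to the last good time of the
    same colour at cost [D], plus [H] for the next step. That colour never recurs among later good
    times, so there are at most [K] jumps. The set [U s] of colours still to come measures
    progress. *)
Lemma sum_le_coloring phi H D n K (good : pred nat) (col : nat -> 'I_K) :
  0 <= H -> 0 <= D -> (forall j, (j < n)%N -> phi j <= H) ->
  (forall s t, (s < t < n)%N -> good s -> good t -> col s = col t ->
    \sum_(s <= j < t) phi j <= D) ->
  \sum_(0 <= j < n) phi j <= H * \sum_(j < n) (~~ good j)%:R + (D + H) * K%:R.
Proof.
move=> H0 D0 phiH SD.
pose U s := [set c : 'I_K | [exists j : 'I_n, [&& (s <= j)%N, good j & col j == c]]]%SET.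
have Usub s t : (s <= t)%N -> (U t \subset U s)%SET.
  move=> st; apply/fintype.subsetP => c; rewrite !inE => /existsP[j /and3P[tj gj cj]].
  by apply/existsP; exists j; rewrite (leq_trans st tj) gj.
suff main m : forall s, (s <= n)%N -> (n - s <= m)%N ->
    \sum_(s <= j < n) phi j <=
    H * \sum_(s <= j < n) (~~ good j)%:R + (D + H) * #|U s|%:R.
  apply: (le_trans (main n 0%N _ _)); rewrite ?subn0// big_mkord lerD2l.
  by rewrite ler_wpM2l ?addr_ge0// ler_nat -[X in (_ <= X)%N]card_ord max_card.
elim: m => [|m IH] s sn nsm.
  by rewrite !big_geq ?mulr0 ?add0r ?mulr_ge0 ?addr_ge0//; lia.
have [ns|{}sn] := leqP n s.
  by rewrite !big_geq ?mulr0 ?add0r ?mulr_ge0 ?addr_ge0//; lia.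
have [gs|bs] := boolP (good s); last first.
  rewrite !(big_ltn sn) (negbTE bs)/= mulrDr mulr1.
  have := IH s.+1 sn ltac:(lia); have := phiH s sn.
  have : (D + H) * #|U s.+1|%:R <= (D + H) * #|U s|%:R :> R.
    by rewrite ler_wpM2l ?addr_ge0// ler_nat subset_leq_card ?Usub.
  lra.
(* [t] will be the last good time with the colour of [s], possibly [s] itself. *)
pose P t := [&& (s <= t < n)%N, good t & col t == col s].
have exP : exists t, P t by exists s; rewrite /P leqnn sn gs/=.
have Pn t : P t -> (t <= n)%N by case/and3P => /andP[_ /ltnW].
case: (ex_maxnP exP Pn) => t /and3P[/andP[st tn] gt /eqP ct] tmax.
rewrite !(big_cat_nat (m := s) (n := t.+1) (p := n))//=; try lia.
rewrite [X in X + _ <= _]big_nat_recr//=.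
have SDt : \sum_(s <= j < t) phi j <= D.
  have [ts|{}st] := leqP t s; first by rewrite big_geq.
  by apply: SD => //; rewrite st tn.
have Ut : (#|U t.+1|.+1 <= #|U s|)%N.
  have csU : col s \in U s.
    by rewrite inE; apply/existsP; exists (Ordinal sn); rewrite leqnn gs/=.
  rewrite (cardsD1 (col s) (U s)) csU ltnS subset_leq_card//.
  apply/fintype.subsetP => c cU.
  rewrite in_setD1 (fintype.subsetP (Usub _ _ _) _ cU) ?andbT; last lia.
  move: cU; rewrite inE => /existsP[j /and3P[tj gj /eqP <-]].
  apply/eqP => cjs; have := tmax j; rewrite /P gj cjs eqxx ltn_ord andbT => /(_ ltac:(lia)); lia.
have : (D + H) * #|U t.+1|.+1%:R <= (D + H) * #|U s|%:R :> R.
  by rewrite ler_wpM2l ?addr_ge0// ler_nat.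
rewrite -natr1 mulrDr mulr1 mulrDr.
have : 0 <= H * \sum_(s <= i < t.+1) (~~ good i)%:R by rewrite mulr_ge0// sumr_ge0.
have := IH t.+1 tn ltac:(lia); have := phiH t tn; lra.
Qed.

(* A time is good when no large negative value of [phi] occurs near it. Values
   below [-C] are expensive since the sums of [phi] around them are bounded, so
   most times are good; between two good times of the same colour nothing is gained. *)
Lemma length_le_coloring phi H D C mu eta eps n K (col : nat -> 'I_K) :
  0 <= H -> 0 <= D -> 0 <= C -> 0 <= mu + eta -> 0 < eps ->
  (forall j, (j < n)%N -> phi j <= H) ->
  (forall s t, (s <= t <= n)%N ->
    \sum_(s <= j < t) phi j <= (mu + eta) * (t - s)%:R + C) ->
  (forall s t, (s < t < n)%N -> col s = col t ->
    (forall j, (s <= j < t)%N ->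
      - (C + eps) - eps * (minn (j - s) (t - j))%:R <= phi j) ->
    \sum_(s <= j < t) phi j <= D) ->
  mu * n%:R <= \sum_(0 <= j < n) phi j ->
  (mu - 2 * H * eta / eps) * n%:R <= 2 * H * C / eps + (D + H) * K%:R.
Proof.
move=> H0 D0 C0 k0 eps0 phiH bound SD Sn.
pose e j : R := Num.max (- phi j - C) 0.
have e0 j : 0 <= e j by rewrite le_max lexx orbT.
pose hit s j := eps * ((s - j) + (j - s)).+1%:R < e j.
pose good s := [forall j : 'I_n, ~~ hit s j].
have goodP s j : (j < n)%N -> good s ->
    - (C + eps) - eps * ((s - j) + (j - s))%:R <= phi j.
  move=> jn /forallP/(_ (Ordinal jn))/=; rewrite /hit -leNgt -natr1 mulrDr mulr1.
  have : - phi j - C <= e j by rewrite le_max lexx.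
  lra.
(* A time [j] with excess [e j] spoils only the times at distance less than about [e j / eps];
   double counting bounds the bad times by the total excess. *)
have bad : \sum_(s < n) (~~ good s)%:R <= 2 / eps * \sum_(j < n) e j.
  apply: (@le_trans _ _ (\sum_(s < n) \sum_(j < n) (hit s j)%:R)).
    apply: ler_sum => s _; case: (boolP (good s)) => [_|]/=; first exact: sumr_ge0.
    rewrite negb_forall => /existsP[j]; rewrite negbK => hj.
    by rewrite (bigD1 j)//= hj lerDl; apply: sumr_ge0.
  rewrite exchange_big/= mulr_sumr; apply: ler_sum => j _.
  by have := count_dist_le eps0 (e0 j) (ltn_ord j); rewrite mulrAC mulrA.
(* The upper bound at rate [mu + eta] and the assumed lower bound at rate [mu] leave room for a
   total excess of at most [eta * n + C]. *)
have esum := sum_excess_le C0 k0 bound (n := n) (m := 0%N).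
rewrite addn0 in esum; have {}esum := esum (leqnn n).
have : \sum_(0 <= j < n) phi j <= H * \sum_(j < n) (~~ good j)%:R + (D + H) * K%:R.
  apply: (sum_le_coloring (col := col)) => // s t stn gs gt cst; apply: SD => // j jst.
  have := goodP s j ltac:(lia) gs; have := goodP t j ltac:(lia) gt.
  have -> : (t - j + (j - t) = t - j)%N by lia.
  have -> : (s - j + (j - s) = j - s)%N by lia.
  by rewrite /minn; case: ltnP.
have {}esum : \sum_(j < n) e j <= eta * n%:R + C.
  by rewrite -[X in _ - X]/(\sum_(j < n) e j) in esum; lra.
have : H * \sum_(j < n) (~~ good j)%:R <= H * (2 / eps * (eta * n%:R + C)).
  by rewrite ler_wpM2l// (le_trans bad)// ler_wpM2l// divr_ge0// ltW.
have -> : H * (2 / eps * (eta * n%:R + C)) = 2 * H * eta / eps * n%:R + 2 * H * C / eps.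
  by field; rewrite gt_eqF.
move=> h1 h2; have := le_trans Sn h2; lra.
Qed.

End RealSequences.

(** * Subexponential growth and nonvanishing of a scalar cocycle with trivial periodic data *)

Definition scalar_growth (R : realType) (M : Type) (f : M -> M) (a : M -> R) (mu : R) :=
  exists2 C : R, 0 <= C & forall n x,
    \prod_(i < n) `|a (iter i f x)| <= expR (mu * n%:R + C).

Section ScalarCocycles.
Variable R : realType.

Lemma powR_small (alpha w : R) : 0 < alpha -> 0 < w ->
  exists2 rho, 0 < rho & forall t, 0 <= t <= rho -> t `^ alpha <= w.
Proof.
move=> al0 w0; exists (w `^ alpha^-1); first exact: powR_gt0.
move=> t /andP[t0 tw].
have -> : w = (w `^ alpha^-1) `^ alpha.
  by rewrite -powRrM mulVf ?gt_eqF// powRr1// ltW.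
by apply: ge0_ler_powR; rewrite ?nnegrE ?powR_ge0// ltW.
Qed.

Lemma prod_1B_ge (r : nat -> R) n : (forall i, (i < n)%N -> 0 <= r i <= 1) ->
  1 - \sum_(i < n) r i <= \prod_(i < n) (1 - r i) <= 1.
Proof.
elim: n => [|n IH] r01; first by rewrite !big_ord0 subr0 lexx.
rewrite !big_ord_recr/=.
have /andP[i1 i2] := IH (fun i h => r01 i (ltnW h)).
have /andP[r0 r1] := r01 n (ltnSn n).
have p0 : 0 <= \prod_(i < n) (1 - r i).
  by apply: prodr_ge0 => i _; rewrite subr_ge0; have /andP[] := r01 i (ltnW (ltn_ord i)).
apply/andP; split; nra.
Qed.

Variables (M : metricType R) (f : M -> M) (alpha : R) (a : M -> R).
Hypothesis alpha0 : 0 < alpha.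
Variables (L H : R).
Hypotheses (L0 : 0 < L) (H0 : 0 < H).
Hypothesis aL : forall x y, `|a x - a y| <= L * mdist x y `^ alpha.
Hypothesis aH : forall x, `|a x| <= expR H.
Hypothesis a1 : forall n p, (1 <= n)%N -> iter n f p = p ->
  \prod_(i < n) a (iter i f p) = 1.

Local Notation growth := (scalar_growth f a).

Section Closing.
Variables (C2 eps0 theta eps : R).
Hypotheses (C20 : 0 < C2) (eps00 : 0 < eps0) (eps_gt0 : 0 < eps).
Hypothesis eps_theta : eps < theta * alpha.
Hypothesis closing : forall z n, mdist (iter n f z) z < eps0 ->
  exists2 p, iter n f p = p & forall j, (j <= n)%N ->
      mdist (iter j f z) (iter j f p)
        <= C2 * expR (- (theta * (minn j (n - j))%:R)) * mdist (iter n f z) z.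

(** The closing orbit has product 1, and its factors differ from those of [z] by relative errors
    [r i]. The factors of [z] may decay at rate [eps < theta * alpha] towards the middle, so the
    errors remain summable; for a close enough return they sum to at most 1/2, whence 1 is at least
    half the product along [z]. *)
Lemma closing_gain c : exists2 rho, 0 < rho & forall z m, (0 < m)%N ->
  mdist (iter m f z) z < rho ->
  (forall i, (i < m)%N -> expR (- c - eps * (minn i (m - i))%:R) <= `|a (iter i f z)|) ->
  \prod_(i < m) `|a (iter i f z)| <= 2.
Proof.
pose Z := shadow_sum (theta * alpha - eps).
have k0 : 0 < theta * alpha - eps by rewrite subr_gt0.
have Z0 : 0 <= Z by exact: shadow_sum_ge0.
have [|w w0 wP] := @powR_small alpha (2 * L * expR c * (Z + 1))^-1 alpha0.
  by rewrite invr_gt0 !mulr_gt0 ?expR_gt0// ltr_wpDl.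
exists (Num.min eps0 (w / C2)); first by rewrite lt_min eps00 divr_gt0.
move=> z m m0; rewrite lt_min => /andP[De Dw] az.
have [p pp pz] := closing De.
pose D := mdist (iter m f z) z.
have D0 : 0 <= D by exact: mdist_ge0.
pose v := (C2 * D) `^ alpha.
have vw : v <= (2 * L * expR c * (Z + 1))^-1.
  apply: wP; rewrite mulr_ge0//=; last exact: ltW.
  by rewrite mulrC -ler_pdivlMr// ltW.
have v0 : 0 <= v by exact: powR_ge0.
pose r i := L * v * expR c * expR (- ((theta * alpha - eps) * (minn i (m - i))%:R)).
have r0 i : 0 <= r i by rewrite /r !mulr_ge0 ?expR_ge0// ltW.
have rsum : \sum_(i < m) r i <= 1 / 2.
  rewrite -mulr_sumr.
  apply: (@le_trans _ _ (L * v * expR c * (Z + 1))).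
    rewrite ler_wpM2l ?mulr_ge0 ?expR_ge0//; first exact: ltW.
    by rewrite (le_trans (sum_expR_minn_le _ _))// /Z lerDl.
  move: vw; rewrite -[_^-1]mul1r ler_pdivlMr; last first.
    by rewrite !mulr_gt0 ?expR_gt0// ltr_wpDl.
  lra.
have r1 i : (i < m)%N -> r i <= 1.
  move=> im; have : r i <= \sum_(i < m) r i.
    by rewrite (bigD1 (Ordinal im))//= lerDl; apply: sumr_ge0.
  lra.
have step (i : nat) : (i < m)%N -> (1 - r i) * `|a (iter i f z)| <= `|a (iter i f p)|.
  move=> im.
  have aa : `|a (iter i f z)| - `|a (iter i f p)| <= r i * `|a (iter i f z)|.
    apply: (le_trans (lerB_dist _ _)); apply: (le_trans (aL _ _)).
    apply: (@le_trans _ _ (r i * expR (- c - eps * (minn i (m - i))%:R))); last first.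
      by rewrite ler_wpM2l// az.
    apply: (@le_trans _ _ (L * (v * expR (- (theta * alpha * (minn i (m - i))%:R))))).
      rewrite ler_pM2l//.
      apply: (@le_trans _ _ ((C2 * D * expR (- (theta * (minn i (m - i))%:R))) `^ alpha)).
        apply: ge0_ler_powR; rewrite ?nnegrE ?mdist_ge0 ?mulr_ge0 ?expR_ge0//; try exact: ltW.
        by apply: (le_trans (pz i (ltnW im))); rewrite mulrAC.
      by rewrite powR_expR// mulr_ge0// ltW.
    rewrite /r -!mulrA ler_pM2l// ler_wpM2l// -!expRD ler_expR; lra.
  lra.
have pr1 : \prod_(i < m) `|a (iter i f p)| = 1.
  by rewrite -normr_prod a1// normr1.
have P0 : 0 <= \prod_(i < m) `|a (iter i f z)| by apply: prodr_ge0.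
have : \prod_(i < m) ((1 - r i) * `|a (iter i f z)|) <= \prod_(i < m) `|a (iter i f p)|.
  by apply: ler_prod => i _; rewrite step// mulr_ge0// subr_ge0 r1.
rewrite pr1 big_split/=.
have /andP[+ _] := @prod_1B_ge r m (fun i im => introT andP (conj (r0 i) (r1 i im))).
nra.
Qed.

(** If a product over [n] steps exceeds [expR (mu * n)], the colouring estimate applied to its
    logarithms bounds [n] by a constant, and the trivial bound [expR (H * n)] is then a constant
    too. *)
Lemma growth_step mu : compact [set: M] -> eps <= mu ->
  growth (mu + eps ^+ 2 / (4 * H)) -> growth mu.
Proof.
move=> cM emu [C C0 CP]; set eta := eps ^+ 2 / (4 * H) in CP.
have eta0 : 0 <= eta by rewrite divr_ge0 ?sqr_ge0// mulr_ge0// ltW.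
have mu0 : 0 < mu by exact: lt_le_trans emu.
have [rho rho0 rhoP] := closing_gain (C + eps).
have [N [col colP]] := compact_coloring cM rho0.
pose W := 2 * H * C / eps + (2 + H) * N%:R.
have W0 : 0 <= W.
  by rewrite addr_ge0 ?mulr_ge0 ?invr_ge0 ?addr_ge0//; exact: ltW.
exists (H * (2 * W / eps)).
  by rewrite !mulr_ge0 ?invr_ge0//; exact: ltW.
move=> n x; have [le|gt] := leP (\prod_(i < n) `|a (iter i f x)|) (expR (mu * n%:R)).
  apply: (le_trans le); rewrite ler_expR lerDl !mulr_ge0 ?invr_ge0//; exact: ltW.
(* A product above a positive number has no zero factor, so logarithms may be taken. *)
have ane0 i : (i < n)%N -> 0 < `|a (iter i f x)|.
  move=> i_n; rewrite normr_gt0; apply/eqP => ai0.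
  move: gt; rewrite (bigD1 (Ordinal i_n))//= ai0 normr0 mul0r.
  by rewrite ltNge expR_ge0.
pose phi i := ln `|a (iter i f x)|.
have phiE s t : (s <= t <= n)%N ->
    expR (\sum_(s <= j < t) phi j) = \prod_(i < t - s) `|a (iter i f (iter s f x))|.
  move=> /andP[st tn]; rewrite expR_sum -{1}(add0n s) big_addn big_mkord.
  apply: eq_bigr => i _; rewrite -iterD /phi lnK// posrE ane0//.
  by rewrite (leq_trans _ tn)// addnC -ltn_subRL ltn_ord.
have phiH j : (j < n)%N -> phi j <= H.
  by move=> jn; rewrite -ler_expR lnK ?posrE ?ane0.
have := @length_le_coloring R phi H 2 C mu eta eps n N (fun i => col (iter i f x)).
(* The choice of [eta] makes the loss equal to [eps / 2], and a positive rate remains since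
   [eps <= mu]. *)
have -> : mu - 2 * H * eta / eps = mu - eps / 2.
  by rewrite /eta; field; rewrite !gt_eqF.
move=> /(_ (ltW H0) ltac:(lra) C0 ltac:(lra) eps_gt0 phiH) len.
have {}len : (mu - eps / 2) * n%:R <= W.
  apply: len.
  - by move=> s t stn; rewrite -ler_expR phiE.
  - move=> s t /andP[st tn] cst good; rewrite -ler_expR phiE; last by rewrite ltnW//= ltnW.
    apply: (@le_trans _ _ 2); last by have := expR_ge1Dx (2 : R); lra.
    apply: rhoP; first by rewrite subn_gt0.
      by apply: colP; rewrite -iterD subnK ?cst// ltnW.
    move=> i i_ts; have is_t : (i + s < t)%N by rewrite addnC -ltn_subRL.
    rewrite -iterD -[leRHS]lnK ?posrE ?ane0 ?(ltn_trans is_t)//.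
    rewrite ler_expR; have := good (i + s)%N; rewrite leq_addl is_t => /(_ isT).
    by rewrite addnK -subnDA (addnC s) opprD.
  - rewrite -ler_expR; have := phiE 0%N n (leqnn n); rewrite [(n - 0)%N]subn0 => ->.
    exact: ltW.
apply: (@le_trans _ _ (expR (H * n%:R))).
  rewrite expRM_natr -[X in _ ^+ X](card_ord n) -prodr_const.
  by apply: ler_prod => i _; rewrite normr_ge0 aH.
rewrite ler_expR; apply: (@le_trans _ _ (H * (2 * W / eps))); last first.
  by rewrite lerDr mulr_ge0// ltW.
rewrite ler_pM2l// ler_pdivlMr//.
have : eps / 2 * n%:R <= (mu - eps / 2) * n%:R by rewrite ler_wpM2r//; lra.
lra.
Qed.

(** The decrement [eta] of the rate does not depend on the current rate, so finitely many steps lead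
    from the trivial rate down to [eps]. *)
Lemma scalar_subexponential : compact [set: M] -> growth eps.
Proof.
move=> cM; set eta := eps ^+ 2 / (4 * H).
have eta0 : 0 < eta by rewrite divr_gt0 ?mulr_gt0// exprn_gt0.
have base : growth (eps + eta * (Num.bound (H / eta))%:R).
  exists 0 => // n x; rewrite addr0.
  apply: (@le_trans _ _ (expR (H * n%:R))).
    rewrite expRM_natr -[X in _ ^+ X](card_ord n) -prodr_const.
    by apply: ler_prod => i _; rewrite normr_ge0 aH.
  rewrite ler_expR ler_wpM2r//.
  have := archi_boundP (divr_ge0 (ltW H0) (ltW eta0)).
  rewrite ltr_pdivrMr// mulrC => /ltW/le_trans; apply.
  by rewrite lerDr ltW.
elim: (Num.bound _) base => [|k IH]; first by rewrite mulr0 addr0.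
rewrite -natr1 mulrDr mulr1 addrA => /growth_step gk; apply: IH; apply: gk => //.
by rewrite lerDl mulr_ge0// ltW.
Qed.

End Closing.

(** A periodic orbit follows [2 * n] iterates with [x] in the middle. Its product is 1 and the other
    factors grow at rate at most [eps], so the middle factor is at least of order
    [expR (- (2 * eps * n))], whereas it differs from [a x] by the smaller order
    [expR (- (theta * alpha * n))]. *)
Lemma scalar_nonvanishing theta eps : growth eps -> 2 * eps < theta * alpha ->
  (exists g, cancel f g /\ cancel g f) ->
  (exists S, (0 < S)%N /\ forall x n, exists p, iter (n + S) f p = p /\
    forall j, (j <= n)%N -> mdist (iter j f p) (iter j f x)
        < expR (- (theta * (minn j (n - j))%:R))) ->
  exists2 c, 0 < c & forall x, c <= `|a x|.
Proof.
move=> [C C0 CP] eps2 [g [fg gf]] [[|S] [// _ spec]].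
have gn n x : iter n f (iter n g x) = x.
  by elim: n x => [//|n IH] x; rewrite iterSr iterS gf IH.
pose w := `|eps| * S.+1%:R + 2 * C.
set kappa := theta * alpha - 2 * eps.
have k0 : 0 < kappa by rewrite subr_gt0.
(* [n], chosen independently of [x], makes the Hoelder error at the midpoint at most half the lower
   bound for the middle factor. *)
have [n nP] : exists n : nat, ln (2 * L) + w <= kappa * n%:R.
  exists (Num.bound ((`|ln (2 * L)| + w) / kappa)); have h : 0 <= (`|ln (2 * L)| + w) / kappa.
    by rewrite divr_ge0 ?(ltW k0)// addr_ge0// /w addr_ge0// mulr_ge0.
  have := archi_boundP h; rewrite ltr_pdivrMr// => /ltW; rewrite (mulrC _ kappa); apply: le_trans.
  by rewrite lerD2r ler_norm.
exists (expR (- (2 * eps * n%:R) - w) / 2); first by rewrite divr_gt0 ?expR_gt0.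
move=> x; have [p [pp px]] := spec (iter n g x) (n + n)%N.
have := px n (leq_addr _ _); rewrite gn addnK minnn => pxn.
have low : expR (- (2 * eps * n%:R) - w) <= `|a (iter n f p)|.
  have := a1 (p := p) (n := (n + n + S).+1).
  rewrite -addnS => /(_ _ pp); rewrite addnS => /(_ isT) /(congr1 Num.norm).
  rewrite normr_prod normr1.
  rewrite -(big_mkord predT (fun i => `|a (iter i f p)|)) (big_cat_nat (n := n))//=;
    last by rewrite ltnW// ltnS -addnA leq_addr.
  rewrite [X in _ * X]big_ltn; last by rewrite ltnS -addnA leq_addr.
  rewrite -(add0n n.+1) big_addn !big_mkord.
  under [X in _ * (_ * X)]eq_bigr do rewrite iterD.
  have h1 := CP n p; have h2 := CP ((n + n + S).+1 - n.+1)%N (iter n.+1 f p).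
  move=> prod1.
  have : 1 <= expR (eps * n%:R + C) * (`|a (iter n f p)| *
      expR (eps * ((n + n + S).+1 - n.+1)%:R + C)).
    rewrite -[leLHS]prod1; apply: ler_pM; [exact: prodr_ge0| |exact: h1|].
      by rewrite mulr_ge0// prodr_ge0.
    by apply: ler_pM => //; exact: prodr_ge0.
  rewrite mulrCA -expRD => one.
  have -> : expR (- (2 * eps * n%:R) - w) = (expR (2 * eps * n%:R + w))^-1.
    by rewrite -expRN; congr expR; lra.
  rewrite -[_^-1]mul1r ler_pdivrMr ?expR_gt0// (le_trans one)// ler_wpM2l//.
  rewrite ler_expR.
  rewrite subSS -addnA addKn natrD /w.
  have : eps * S%:R <= `|eps| * S.+1%:R.
    by rewrite (le_trans (ler_wpM2r _ (ler_norm _)))// ler_wpM2l// ler_nat.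
  lra.
have up : `|a (iter n f p)| <= `|a x| + L * expR (- (theta * alpha * n%:R)).
  have := lerB_dist (a (iter n f p)) (a x).
  have := aL (iter n f p) x.
  have : mdist (iter n f p) x `^ alpha <= expR (- (theta * alpha * n%:R)).
    have := @powR_expR R 1 theta n%:R alpha ler01; rewrite powR1 !mul1r => <-.
    by apply: ge0_ler_powR; rewrite ?nnegrE ?mdist_ge0 ?expR_ge0//; exact: ltW.
  rewrite -(ler_pM2l L0); lra.
have : L * expR (- (theta * alpha * n%:R)) <= expR (- (2 * eps * n%:R) - w) / 2.
  rewrite ler_pdivlMr// mulrC mulrA -[2 * L]lnK ?posrE ?mulr_gt0// -expRD ler_expR.
  by move: nP; rewrite /kappa; lra.
lra.
Qed.

End ScalarCocycles.

(** * Bounded Hoelder functions, determinants and bounded inverses *)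

Section BoundedHoelder.
Variables (R : realType) (M : metricType R) (alpha : R).

(** Boundedness is included so that the class is stable under products, and hence contains
    determinants. *)
Definition bounded_hoelder (F : M -> R) := exists2 C, 0 <= C &
  (forall x, `|F x| <= C) /\ forall x y, `|F x - F y| <= C * mdist x y `^ alpha.

Lemma bounded_hoelder_cst c : bounded_hoelder (fun=> c).
Proof.
exists `|c| => //; split=> // x y.
by rewrite subrr normr0 mulr_ge0// powR_ge0.
Qed.

Lemma bounded_hoelderD F G : bounded_hoelder F -> bounded_hoelder G ->
  bounded_hoelder (fun x => F x + G x).
Proof.
move=> [C C0 [Fb Fh]] [D D0 [Gb Gh]]; exists (C + D); first exact: addr_ge0.
split=> [x|x y]; first by rewrite (le_trans (ler_normD _ _))// lerD.
by rewrite opprD addrACA (le_trans (ler_normD _ _))// mulrDl lerD.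
Qed.

Lemma bounded_hoelderM F G : bounded_hoelder F -> bounded_hoelder G ->
  bounded_hoelder (fun x => F x * G x).
Proof.
move=> [C C0 [Fb Fh]] [D D0 [Gb Gh]].
have CD : 0 <= C * D by exact: mulr_ge0.
exists (2 * (C * D)); first by rewrite mulr_ge0.
split=> [x|x y].
  by rewrite normrM (le_trans (ler_pM _ _ (Fb x) (Gb x)))//; lra.
have -> : F x * G x - F y * G y = (F x - F y) * G x + F y * (G x - G y) by ring.
rewrite (le_trans (ler_normD _ _))// !normrM.
have := ler_pM (normr_ge0 _) (normr_ge0 _) (Fh x y) (Gb x).
have := ler_pM (normr_ge0 _) (normr_ge0 _) (Fb y) (Gh x y).
nra.
Qed.

Lemma bounded_hoelder_sum I (r : seq I) (F : I -> M -> R) :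
  (forall i, bounded_hoelder (F i)) -> bounded_hoelder (fun x => \sum_(i <- r) F i x).
Proof.
move=> Fh; elim: r => [|i r IH].
  by under eq_fun do rewrite big_nil; exact: bounded_hoelder_cst.
by under eq_fun do rewrite big_cons; exact: bounded_hoelderD.
Qed.

Lemma bounded_hoelder_prod I (r : seq I) (F : I -> M -> R) :
  (forall i, bounded_hoelder (F i)) -> bounded_hoelder (fun x => \prod_(i <- r) F i x).
Proof.
move=> Fh; elim: r => [|i r IH].
  by under eq_fun do rewrite big_nil; exact: bounded_hoelder_cst.
by under eq_fun do rewrite big_cons; exact: bounded_hoelderM.
Qed.

Lemma bounded_hoelder_det n (B : M -> 'M[R]_n) :
  (forall i j, bounded_hoelder (fun x => B x i j)) ->
  bounded_hoelder (fun x => \det (B x)).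
Proof.
move=> Bh; apply: bounded_hoelder_sum => s.
apply: bounded_hoelderM; first exact: bounded_hoelder_cst.
exact: bounded_hoelder_prod.
Qed.

(** Points of one colour are at distance less than 1, so [A] varies by at most [L] on each of
    finitely many colours. *)
Lemma hoelder_bounded_mx d (A : M -> 'M[R]_d) (L : R) : compact [set: M] -> 0 <= alpha -> 0 <= L ->
  (forall x y, mnorm (A x - A y) <= L * mdist x y `^ alpha) ->
  exists2 K, 0 <= K & forall x, mnorm (A x) <= K.
Proof.
move=> cM al0 L0 AL; have [N [col colP]] := compact_coloring cM (@ltr01 R).
have /choice[b bP] : forall c : 'I_N, exists b : R, 0 <= b /\
    forall x, col x = c -> mnorm (A x) <= b.
  move=> c; have [[y yc]|no] := pselect (exists y, col y = c); last first.
    by exists 0; split=> // x xc; case: no; exists x.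
  exists (mnorm (A y) + L); split; first by rewrite addr_ge0// mnorm_ge0.
  move=> x xc; have := ler_mnormD (A y) (A x - A y); rewrite addrC subrK => /le_trans.
  apply; rewrite lerD2l (le_trans (AL _ _))// ler_piMr//.
  have <- : 1 `^ alpha = 1 :> R by rewrite powR1.
  apply: ge0_ler_powR; rewrite ?nnegrE ?mdist_ge0//.
  by apply/ltW/colP; rewrite xc.
exists (\sum_c b c); first by apply: sumr_ge0 => c _; case: (bP c).
move=> x; rewrite (bigD1 (col x))//=; have [_ /(_ x erefl)] := bP (col x).
move=> /le_trans; apply; rewrite lerDl; apply: sumr_ge0 => c _.
by case: (bP c).
Qed.

(** The inverse is the adjugate divided by the determinant, and the entries of the adjugate are
    bounded as signed minors. *)
Lemma bounded_invmx d (A : M -> 'M[R]_d) (c : R) : 0 < c ->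
  (forall i j, bounded_hoelder (fun x => A x i j)) ->
  (forall x, c <= `|\det (A x)|) ->
  (forall x, A x \in unitmx) /\
  exists2 K, 0 <= K & forall x, mnorm (invmx (A x)) <= K.
Proof.
move=> c0 Ah detc.
have Au x : A x \in unitmx.
  by rewrite unitmxE unitfE -normr_gt0 (lt_le_trans c0).
split=> //.
have /choice[b bP] : forall ij : 'I_d * 'I_d, exists b : R, 0 <= b /\
    forall x, `|(\adj (A x)) ij.1 ij.2| <= b.
  move=> [i j] /=.
  have [||C C0 [CP _]] := @bounded_hoelderM (fun=> (-1) ^+ (j + i))
      (fun x => \det (row' j (col' i (A x)))).
  - exact: bounded_hoelder_cst.
  - apply: bounded_hoelder_det => k l.
    by under eq_fun do rewrite !mxE.
  - by exists C; split=> // x; rewrite mxE; exact: CP.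
exists (c^-1 * \sum_ij b ij).
  by rewrite mulr_ge0 ?invr_ge0 ?(ltW c0)//; apply: sumr_ge0 => ij _; case: (bP ij).
move=> x; rewrite /mnorm pair_big/= mulr_sumr; apply: ler_sum => -[i j] _ /=.
rewrite /invmx Au mxE normrM ler_pM//; last by case: (bP (i, j)) => _ /(_ x).
by rewrite normfV lef_pV2 ?posrE// (lt_le_trans c0).
Qed.

End BoundedHoelder.

(** * Algebra of matrix cocycles *)

Lemma invmx_eq (R : realType) n (X Y : 'M[R]_n) : X *m Y = 1%:M -> invmx Y = X.
Proof.
move=> XY; have [_ Yu] := mulmx1_unit XY.
by rewrite -[RHS]mulmx1 -(mulmxV Yu) mulmxA XY mul1mx.
Qed.

Section CocycleAlgebra.
Variables (R : realType) (M : Type) (d : nat) (f : M -> M) (A : M -> 'M[R]_d).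

Lemma cocycleD m n x :
  cocycle f A (m + n) x = cocycle f A m (iter n f x) *m cocycle f A n x.
Proof.
elim: m => [|m IH]; first by rewrite mul1mx.
by rewrite addSn /= IH mulmxA iterD.
Qed.

Lemma det_cocycle n x :
  \det (cocycle f A n x) = \prod_(i < n) \det (A (iter i f x)).
Proof.
elim: n => [|n IH]; first by rewrite big_ord0 det1.
by rewrite big_ord_recr/= det_mulmx IH mulrC.
Qed.

(** Telescoping over the time [i] at which the product passes from the orbit of [y] to that of
    [x]. *)
Lemma cocycleB n x y : cocycle f A n x - cocycle f A n y =
  \sum_(i < n) cocycle f A (n - i.+1) (iter i.+1 f x) *m
    (A (iter i f x) - A (iter i f y)) *m cocycle f A i y.
Proof.
elim: n => [|n IH]; first by rewrite big_ord0 subrr.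
rewrite big_ord_recr/= subnn/= mul1mx.
have -> : A (iter n f x) *m cocycle f A n x - A (iter n f y) *m cocycle f A n y =
    A (iter n f x) *m (cocycle f A n x - cocycle f A n y) +
    (A (iter n f x) - A (iter n f y)) *m cocycle f A n y.
  by rewrite mulmxBr mulmxBl addrA subrK.
congr (_ + _); rewrite IH mulmx_sumr; apply: eq_bigr => i _.
rewrite subSS -(subnSK (ltn_ord i)) /= -[f (iter i f x)]/(iter i.+1 f x).
by rewrite -iterD subnK ?ltn_ord// !mulmxA.
Qed.

Lemma mnorm_cocycle_le K n x : 0 <= K -> (forall x, mnorm (A x) <= K) ->
  mnorm (cocycle f A n x) <= d%:R * K ^+ n.
Proof.
move=> K0 AK; elim: n => [|n IH]/=; first by rewrite expr0 mulr1 mnorm1.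
rewrite (le_trans (ler_mnormM _ _))// exprS mulrCA.
by rewrite ler_pM ?mnorm_ge0.
Qed.

Hypothesis Au : forall x, A x \in unitmx.

Lemma cocycle_unit n x : cocycle f A n x \in unitmx.
Proof.
by elim: n => [|n IH]/=; rewrite ?unitmx1// unitmx_mul Au.
Qed.

Lemma mnorm_invmx_cocycle_le K n x : 0 <= K -> (forall x, mnorm (invmx (A x)) <= K) ->
  mnorm (invmx (cocycle f A n x)) <= d%:R * K ^+ n.
Proof.
move=> K0 AK; elim: n => [|n IH]/=; first by rewrite expr0 mulr1 invmx1 mnorm1.
have -> : invmx (A (iter n f x) *m cocycle f A n x) =
    invmx (cocycle f A n x) *m invmx (A (iter n f x)).
  by apply: invmx_eq; rewrite mulmxA mulmxKV ?mulVmx ?Au ?cocycle_unit.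
rewrite (le_trans (ler_mnormM _ _))// exprSr mulrA.
by rewrite ler_pM ?mnorm_ge0.
Qed.

End CocycleAlgebra.

(** * Boundedness of the matrix cocycle and of its inverses *)

Definition cocycle_growth (R : realType) (M : Type) (d : nat) (f : M -> M)
    (A : M -> 'M[R]_d) (mu : R) :=
  exists2 C : R, 0 <= C & forall n x, mnorm (cocycle f A n x) <= C * expR (mu * n%:R).

Section MatrixCocycles.
Variables (R : realType) (M : metricType R) (d : nat) (f : M -> M).
Variables (A : M -> 'M[R]_d) (alpha L theta : R).
Hypotheses (alpha0 : 0 < alpha) (L0 : 0 < L) (theta0 : 0 < theta).
Hypothesis AL : forall x y, mnorm (A x - A y) <= L * mdist x y `^ alpha.
Hypothesis A1 : forall n p, (1 <= n)%N -> iter n f p = p -> cocycle f A n p = 1%:M.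

Let ta0 : 0 < theta * alpha. Proof. exact: mulr_gt0. Qed.

(** In each telescoping term the Hoelder factor decays at rate [theta * alpha] in the distance to
    the nearer end, which beats the growth [eta] allowed to the outer factors. *)
Lemma cocycle_shadow_le n x y (D B eta : R) : 0 <= D -> 0 <= B -> eta < theta * alpha ->
  (forall i, (i < n)%N -> mdist (iter i f x) (iter i f y)
      <= D * expR (- (theta * (minn i (n - i))%:R))) ->
  (forall i, (i < n)%N -> mnorm (cocycle f A (n - i.+1) (iter i.+1 f x)) *
      mnorm (cocycle f A i y) <= B * expR (eta * (minn i (n - i))%:R)) ->
  mnorm (cocycle f A n x - cocycle f A n y) <=
    L * D `^ alpha * B * shadow_sum (theta * alpha - eta).
Proof.
move=> D0 B0 eta_ta xy AB; rewrite cocycleB.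
apply: (@le_trans _ _ (\sum_(i < n) L * D `^ alpha * B *
    expR (- ((theta * alpha - eta) * (minn i (n - i))%:R)))); last first.
  rewrite -mulr_sumr ler_wpM2l ?mulr_ge0 ?powR_ge0 ?(ltW L0)//.
  by apply: sum_expR_minn_le; rewrite subr_gt0.
elim/big_ind2 : _ => [|X b Y c Xb Yc|i _]; first by rewrite mnorm0.
  by rewrite (le_trans (ler_mnormD _ _))// lerD.
rewrite (le_trans (ler_mnormM _ _))//.
apply: (le_trans (ler_wpM2r (mnorm_ge0 _) (ler_mnormM _ _))).
rewrite mulrAC.
have Ai : mnorm (A (iter i f x) - A (iter i f y)) <=
    L * (D `^ alpha * expR (- (theta * alpha * (minn i (n - i))%:R))).
  apply: (le_trans (AL _ _)); rewrite ler_pM2l// -powR_expR//.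
  apply: ge0_ler_powR; rewrite ?nnegrE ?mdist_ge0 ?mulr_ge0 ?expR_ge0 ?xy//; exact: ltW.
apply: (le_trans (ler_pM _ _ (AB i (ltn_ord i)) Ai)); rewrite ?mulr_ge0 ?mnorm_ge0//.
rewrite [leLHS](_ : _ = L * D `^ alpha * B * (expR (eta * (minn i (n - i))%:R) *
  expR (- (theta * alpha * (minn i (n - i))%:R)))); last by ring.
rewrite -expRD ler_wpM2l ?mulr_ge0 ?powR_ge0 ?(ltW L0)// ler_expR; lra.
Qed.

Hypothesis spec : forall delta : R, 0 < delta -> exists S, (0 < S)%N /\
  forall x n, exists p, iter (n + S) f p = p /\
    forall j, (j <= n)%N -> mdist (iter j f p) (iter j f x)
        < delta * expR (- (theta * (minn j (n - j))%:R)).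

Local Notation growth := (cocycle_growth f A).

Variables (K K' : R).
Hypotheses (K0 : 0 <= K) (K'0 : 0 <= K').
Hypothesis AK : forall x, mnorm (A x) <= K.
Hypothesis Au : forall x, A x \in unitmx.
Hypothesis AK' : forall x, mnorm (invmx (A x)) <= K'.

(** A bound [g * expR (mu * m)] improves itself: in each telescoping term the longer outer product
    is estimated by [g] at rate [mu], the shorter one by [C] at rate [mu + eta]. Fine shadowing then
    turns [g] into [b + g / 2], where [b] bounds the cocycle on the periodic orbit. *)
Lemma cocycle_growth_step (mu : R) : 0 <= mu -> growth (mu + theta * alpha / 2) -> growth mu.
Proof.
have [eta etaD] : exists eta, eta = theta * alpha / 2 by eexists.
rewrite -etaD => mu0 [C C0 CP].
have eta0 : 0 < eta by rewrite etaD divr_gt0.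
have etaE : theta * alpha - eta = eta by rewrite etaD; lra.
pose Z := shadow_sum eta; have Z0 : 0 <= Z by exact: shadow_sum_ge0.
have [|delta delta0 deltaP] := @powR_small R alpha (2 * L * (C + 1) * (Z + 1))^-1 alpha0.
  by rewrite invr_gt0 !mulr_gt0// ltr_wpDl.
have [S [S0 specS]] := spec delta0.
pose b := d%:R * K' ^+ S; have b0 : 0 <= b by rewrite mulr_ge0// exprn_ge0.
have small : L * delta `^ alpha * C * Z <= 1 / 2.
  have : delta `^ alpha <= (2 * L * (C + 1) * (Z + 1))^-1.
    by apply: deltaP; rewrite ltW//=.
  have := powR_ge0 delta alpha; set v := delta `^ alpha => v0.
  rewrite -[_^-1]mul1r ler_pdivlMr ?mulr_gt0// ?ltr_wpDl// => vle.
  have h0 : 0 <= L * v by rewrite mulr_ge0// ltW.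
  have h1 : L * v * (C * Z) <= L * v * ((C + 1) * (Z + 1)).
    by rewrite ler_wpM2l// ler_pM// lerDl.
  lra.
have step n (g : R) : 0 <= g ->
    (forall m x, (m <= n)%N -> mnorm (cocycle f A m x) <= g * expR (mu * m%:R)) ->
    forall m x, (m <= n)%N -> mnorm (cocycle f A m x) <= (b + g / 2) * expR (mu * m%:R).
  move=> g0 gP m x mn.
  have [p [pp px]] := specS x m.
  have pb : mnorm (cocycle f A m p) <= b.
    (* Since the whole product along [p] is the identity, its first [m] steps invert the remaining
       [S] steps, whatever [m] is. *)
    have <- : invmx (cocycle f A S (iter m f p)) = cocycle f A m p.
      apply: invmx_eq; have := A1 _ pp; rewrite addn_gt0 S0 orbT => /(_ isT).
      by rewrite addnC cocycleD => /mulmx1C.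
    exact: mnorm_invmx_cocycle_le.
  have xp : mnorm (cocycle f A m p - cocycle f A m x) <=
      L * delta `^ alpha * (g * C * expR (mu * m%:R)) * Z.
    rewrite /Z -etaE; apply: cocycle_shadow_le => //.
    - exact: ltW.
    - by rewrite !mulr_ge0// expR_ge0.
    - by rewrite -subr_gt0 etaE.
    - by move=> i im; exact/ltW/px/ltnW.
    move=> i im; rewrite /minn; case: ifP => _.
      have := ler_pM (mnorm_ge0 _) (mnorm_ge0 _)
        (gP (m - i.+1)%N (iter i.+1 f p) (leq_trans (leq_subr _ _) mn)) (CP i x).
      move=> /le_trans; apply; rewrite mulrACA -!mulrA !ler_wpM2l// -!expRD ler_expR.
      rewrite natrB// -natr1; lra.
    have := ler_pM (mnorm_ge0 _) (mnorm_ge0 _)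
      (CP (m - i.+1)%N (iter i.+1 f p)) (gP i x (ltnW (leq_trans im mn))).
    move=> /le_trans; apply; rewrite mulrACA (mulrC C) -!mulrA !ler_wpM2l// -!expRD ler_expR.
    rewrite !natrB// ?(ltnW im)// -natr1; lra.
  have -> : cocycle f A m x = cocycle f A m p - (cocycle f A m p - cocycle f A m x).
    by rewrite opprB addrC subrK.
  rewrite (le_trans (ler_mnormB _ _))// mulrDl lerD//.
    by rewrite (le_trans pb)// ler_peMr// -[leLHS]expR0 ler_expR mulr_ge0.
  apply: (le_trans xp).
  have : 0 <= g * expR (mu * m%:R) by rewrite mulr_ge0// expR_ge0.
  move=> h; have := ler_wpM2l h small; lra.
exists (2 * b + 1); first by rewrite addr_ge0// mulr_ge0.
(* The starting constant [g0] depends on [n], but after [k] improvements it enters only as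
   [g0 / 2 ^+ k], so the final constant [2 * b + 1] does not. *)
move=> n x; pose g0 := C * expR (eta * n%:R).
have g00 : 0 <= g0 by rewrite mulr_ge0// expR_ge0.
have iter_step k : forall m y, (m <= n)%N ->
    mnorm (cocycle f A m y) <= (2 * b + g0 / 2 ^+ k) * expR (mu * m%:R).
  elim: k => [|k IH] m y mn.
    rewrite expr0 divr1 (le_trans (CP m y))//.
    apply: (@le_trans _ _ (g0 * expR (mu * m%:R))).
      rewrite /g0 -!mulrA ler_wpM2l// -expRD ler_expR mulrDl addrC.
      by rewrite lerD2r ler_pM2l// ler_nat.
    by rewrite ler_wpM2r ?expR_ge0// lerDr mulr_ge0.
  have gk0 : 0 <= 2 * b + g0 / 2 ^+ k.
    apply: addr_ge0; first exact: mulr_ge0.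
    by rewrite divr_ge0 ?exprn_ge0.
  apply: (le_trans (step n _ gk0 IH m y mn)).
  rewrite ler_wpM2r ?expR_ge0// exprS invfM; lra.
apply: (le_trans (iter_step (Num.bound g0) n x (leqnn n))).
rewrite ler_wpM2r ?expR_ge0// lerD2l ler_pdivrMr ?exprn_gt0// mul1r.
rewrite (le_trans (ltW (archi_boundP g00)))// -natrX ler_nat ltnW//.
exact: ltn_expl.
Qed.

Lemma cocycle_bounded : exists2 Lam : R, 0 <= Lam & forall n x, mnorm (cocycle f A n x) <= Lam.
Proof.
have eta0 : 0 < theta * alpha / 2 by rewrite divr_gt0.
have base : growth (0 + theta * alpha / 2 * (Num.bound (K / (theta * alpha / 2)))%:R).
  exists d%:R => // n x; rewrite add0r.
  apply: (le_trans (mnorm_cocycle_le f n x K0 AK)); rewrite ler_wpM2l//.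
  rewrite expRM_natr lerXn2r ?nnegrE ?expR_ge0//.
  apply: (@le_trans _ _ (expR K)); first by have := expR_ge1Dx K; lra.
  rewrite ler_expR; have := archi_boundP (divr_ge0 K0 (ltW eta0)).
  by rewrite ltr_pdivrMr// mulrC => /ltW.
suff [C C0 CP] : growth 0.
  by exists C => // n x; rewrite (le_trans (CP n x))// mul0r expR0 mulr1.
elim: (Num.bound _) base => [|k IH]; first by rewrite mulr0 addr0.
rewrite -(natr1 k) mulrDr mulr1 addrA => /cocycle_growth_step gk; apply: IH; apply: gk => //.
by rewrite add0r mulr_ge0// ltW.
Qed.

(** On the shadowing periodic orbit the inverse of the cocycle is again a value of the cocycle,
    hence bounded by [B]; [delta] is small enough for this to persist at [x] by perturbation. *)
Lemma invmx_cocycle_bounded : exists2 Lam : R, 0 <= Lam &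
  forall n x, mnorm (cocycle f A n x) <= Lam /\ mnorm (invmx (cocycle f A n x)) <= Lam.
Proof.
have [B B0 BP] := cocycle_bounded; exists (2 * B); first by rewrite mulr_ge0.
pose Z := shadow_sum (theta * alpha - 0).
have Z0 : 0 <= Z by apply: shadow_sum_ge0; rewrite subr0.
have [|delta delta0 deltaP] := @powR_small R alpha (2 * L * (B * B * B + 1) * (Z + 1))^-1 alpha0.
  by rewrite invr_gt0 !mulr_gt0// ltr_wpDl// !mulr_ge0.
have BBB0 : 0 <= B * B * B by rewrite !mulr_ge0.
have [S [S0 specS]] := spec delta0.
move=> n x; split; first by have := BP n x; lra.
have [p [pp px]] := specS x n.
have xp : mnorm (cocycle f A n p - cocycle f A n x) <=
    L * delta `^ alpha * (B * B) * Z.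
  apply: cocycle_shadow_le => //; first exact: ltW.
  - by rewrite mulr_ge0.
  - by move=> i im; exact/ltW/px/ltnW.
  - by move=> i im; rewrite mul0r expR0 mulr1 ler_pM ?mnorm_ge0.
have /(@unitmx_perturb R d (cocycle f A n p) (cocycle f A n x) B)[] //:
    cocycle f A n p \in unitmx by exact: cocycle_unit.
  suff -> : invmx (cocycle f A n p) = cocycle f A S (iter n f p) by [].
  apply: invmx_eq; have := A1 _ pp; rewrite addn_gt0 S0 orbT => /(_ isT).
  by rewrite addnC cocycleD.
rewrite mnormB (le_trans (ler_wpM2l B0 xp))//.
have : delta `^ alpha <= (2 * L * (B * B * B + 1) * (Z + 1))^-1.
  by apply: deltaP; rewrite ltW//=.
have := powR_ge0 delta alpha; set v := delta `^ alpha => v0.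
rewrite -[_^-1]mul1r ler_pdivlMr ?mulr_gt0// ?ltr_wpDl// => vle.
have h0 : 0 <= L * v by rewrite mulr_ge0// ltW.
have h1 : L * v * (B * B * B * Z) <= L * v * ((B * B * B + 1) * (Z + 1)).
  by rewrite ler_wpM2l// ler_pM// lerDl.
lra.
Qed.

End MatrixCocycles.

(** * Limits of bounded matrices along an ultrafilter *)

Lemma ultra_limit_mx (R : realType) d (T : Type) (U : set_system T) (Q : T -> 'M[R]_d) (b : R) :
  UltraFilter U -> (forall k, mnorm (Q k) <= b) ->
  exists P, forall e, 0 < e -> U [set k | mnorm (Q k - P) < e].
Proof.
move=> UU Qb.
have /choice[P PP] : forall ij : 'I_d * 'I_d, exists l : R, forall e, 0 < e ->
    U [set k | `|Q k ij.1 ij.2 - l| < e].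
  move=> [i j] /=; pose u k : R := Q k i j.
  have [|l [_ lP]] := @segment_compact R (- b) b (u @ U) _.
  - apply: (@filterS _ U _ setT); last exact: filterT.
    move=> k _ /=.
    by rewrite in_itv/= -ler_norml (le_trans (mnorm_entry _ _ _)).
  - exists l => e e0.
    (* Otherwise the complement belongs to [U], which contradicts that [l] is a cluster point. *)
    have [//|Uc] := in_ultra_setVsetC [set k | `|u k - l| < e] UU.
    have [||y [[k kc <-] kb]] := lP (u @` (~` [set k | `|u k - l| < e])) (ball l e).
    + by apply: (@filterS _ U _ (~` [set k | `|u k - l| < e])) => // k kc; exists k.
    + exact: nbhsx_ballx.
    by case: kc; rewrite /= distrC.
exists (\matrix_(i, j) P (i, j)) => e e0.
have e'0 : 0 < e / (d * d).+1%:R by rewrite divr_gt0.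
have := @filter_forall _ _ (fun ij k => `|Q k ij.1 ij.2 - P ij| < e / (d * d).+1%:R) U _
  (fun ij => PP ij _ e'0).
move=> /(_ _); apply: (@filterS _ U _) => k Qk /=.
apply: (@le_lt_trans _ _ ((e / (d * d).+1%:R) *+ (d * d))).
  by apply: ler_mnorm_mx => i j; rewrite !mxE; apply/ltW/(Qk (i, j)).
rewrite -mulr_natr mulrAC ltr_pdivrMr// ltr_pM2l// ltr_nat//.
Qed.

(** * Nearly dense orbits of a transitive map *)

Section DenseOrbits.
Variables (R : realType) (M : metricType R) (f : M -> M).
Hypotheses (cf : continuous f) (ft : topologically_transitive f).

Lemma continuous_iter n : continuous (iter n f).
Proof.
elim: n => [|n IH] x; first exact: cvg_id.
have h : (f \o iter n f) @ x --> f (iter n f x).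
  by apply: continuous_comp; [exact: IH|exact: cf].
exact: h.
Qed.

(** Transitivity gives a point of [U] that visits the ball around the first target; by continuity a
    smaller open set does so at the same time, and the remaining targets are treated inside it. *)
Lemma transitive_visits (e : R) (s : seq M) (U : set M) : 0 < e -> open U -> U !=set0 ->
  exists V : set M, [/\ open V, V !=set0, V `<=` U &
    forall x y, V x -> y \in s -> exists n, mdist y (iter n f x) < e].
Proof.
move=> e0; elim: s U => [|y s IH] U oU U0; first by exists U; split.
have [|n [_ [[x Ux <-] xB]]] := ft oU (@open_interior _ (ball y e)) U0.
  by exists y; exact: nbhsx_ballx.
have [||V [oV V0 VU Vs]] := IH (U `&` iter n f @^-1` (ball y e)°).
- apply: openI => //; apply: open_comp; last exact: open_interior.
  by move=> ? _; exact: continuous_iter.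
- by exists x.
exists V; split=> // [z /VU[]//|z w Vz].
rewrite inE => /orP[/eqP ->|ws]; last exact: Vs.
exists n; have [_ /interior_subset] := VU _ Vz.
by rewrite ballEmdist.
Qed.

Lemma nearly_dense_orbit (e : R) : compact [set: M] -> M -> 0 < e ->
  exists x, forall y, exists n, mdist (iter n f x) y < e.
Proof.
move=> cM x0 e0; have e20 : 0 < e / 2 by rewrite divr_gt0.
have [N [col colP]] := compact_coloring cM e20.
(* One representative per colour; a colour that does not occur gets the arbitrary value [x0]. *)
have /choice[r rP] : forall c : 'I_N, exists z, forall y, col y = c -> col z = c.
  move=> c; have [[y yc]|no] := pselect (exists y, col y = c); first by exists y.
  by exists x0 => y yc; case: no; exists y.
have [||V [_ [x Vx] _ VP]] := @transitive_visits (e / 2) [seq r c | c <- enum 'I_N] setT e20.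
- exact: openT.
- by exists x0.
exists x => y.
have [|n xn] := VP x (r (col y)) Vx; first by apply/map_f; rewrite mem_enum.
exists n; have := metric_triangle (iter n f x) (r (col y)) y.
have := colP _ _ (rP (col y) y erefl); rewrite (metric_sym (iter n f x) (r (col y))).
by move: xn; lra.
Qed.

End DenseOrbits.

(** * Hoelder dependence along orbits and the transfer map *)

Section Transfer.
Variables (R : realType) (M : metricType R) (d : nat) (f : M -> M).
Variables (A : M -> 'M[R]_d) (alpha L theta Lam : R).
Hypotheses (alpha0 : 0 < alpha) (L0 : 0 < L) (theta0 : 0 < theta) (Lam0 : 0 <= Lam).
Hypothesis AL : forall x y, mnorm (A x - A y) <= L * mdist x y `^ alpha.
Hypothesis A1 : forall n p, (1 <= n)%N -> iter n f p = p -> cocycle f A n p = 1%:M.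
Hypothesis ALam : forall n x, mnorm (cocycle f A n x) <= Lam.

Lemma cocycle_orbit_hoelder (C2 eps0 : R) : 0 < C2 -> 0 < eps0 ->
  (forall z n, mdist (iter n f z) z < eps0 ->
    exists2 p, iter n f p = p & forall j, (j <= n)%N ->
      mdist (iter j f z) (iter j f p)
        <= C2 * expR (- (theta * (minn j (n - j))%:R)) * mdist (iter n f z) z) ->
  exists2 C : R, 0 <= C & forall x i j, mnorm (cocycle f A i x - cocycle f A j x) <=
    C * mdist (iter i f x) (iter j f x) `^ alpha.
Proof.
move=> C20 eps00 closing; have ta0 : 0 < theta * alpha by exact: mulr_gt0.
pose Z := shadow_sum (theta * alpha - 0).
have Z0 : 0 <= Z by apply: shadow_sum_ge0; rewrite subr0.
pose C3 := L * C2 `^ alpha * (Lam * Lam) * Z.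
have C30 : 0 <= C3.
  apply: mulr_ge0 => //; apply: mulr_ge0; last exact: mulr_ge0.
  by rewrite mulr_ge0 ?powR_ge0 ?(ltW L0).
pose C4 := 2 * Lam / eps0 `^ alpha.
have C40 : 0 <= C4 by rewrite /C4 divr_ge0 ?mulr_ge0 ?powR_ge0.
exists (C3 * Lam + C4); first by apply: addr_ge0 => //; exact: mulr_ge0.
move=> x; suff main i n : mnorm (cocycle f A i x - cocycle f A (n + i) x) <=
    (C3 * Lam + C4) * mdist (iter (n + i) f x) (iter i f x) `^ alpha.
  move=> i j; have [ij|/ltnW ji] := leqP i j.
    by rewrite metric_sym -(subnK ij).
  by rewrite mnormB -{1 2}(subnK ji).
have [Dlt|Dge] := ltP (mdist (iter (n + i) f x) (iter i f x)) eps0; last first.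
  apply: (@le_trans _ _ (Lam + Lam)).
    by rewrite (le_trans (ler_mnormB _ _))// lerD.
  apply: (@le_trans _ _ (C4 * mdist (iter (n + i) f x) (iter i f x) `^ alpha)).
    rewrite /C4 mulrAC ler_pdivlMr ?powR_gt0//.
    have -> : Lam + Lam = 2 * Lam by lra.
    rewrite ler_wpM2l ?mulr_ge0//; apply: ge0_ler_powR; rewrite ?nnegrE ?mdist_ge0//; exact: ltW.
  by rewrite ler_wpM2r ?powR_ge0// lerDr mulr_ge0.
(* A return after no steps is separate, as the periodic data are given for positive periods only. *)
case: n Dlt => [|n] Dlt.
  by rewrite add0n subrr mnorm0 mulr_ge0 ?powR_ge0// addr_ge0// mulr_ge0.
rewrite iterD in Dlt; have [p pp pz] := closing _ _ Dlt.
set z := iter i f x in pz Dlt *; set D := mdist _ z in pz.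
have D0 : 0 <= D by exact: mdist_ge0.
have zp : mnorm (cocycle f A n.+1 z - cocycle f A n.+1 p) <= C3 * D `^ alpha.
  apply: (@le_trans _ _ (L * (C2 * D) `^ alpha * (Lam * Lam) * Z)).
    apply: cocycle_shadow_le => //.
    - by rewrite mulr_ge0// ltW.
    - by rewrite mulr_ge0.
    - by move=> k kn; rewrite (le_trans (pz k (ltnW kn)))// mulrAC.
    - by move=> k kn; rewrite mul0r expR0 mulr1 ler_pM ?mnorm_ge0.
  rewrite powRM ?(ltW C20)// /C3; lra.
have -> : cocycle f A i x - cocycle f A (n.+1 + i) x =
    (cocycle f A n.+1 p - cocycle f A n.+1 z) *m cocycle f A i x.
  by rewrite cocycleD (A1 _ pp)// mulmxBl mul1mx.
rewrite (le_trans (ler_mnormM _ _))// mnormB iterD.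
apply: (@le_trans _ _ (C3 * D `^ alpha * Lam)); first by rewrite ler_pM ?mnorm_ge0.
by rewrite mulrDl mulrAC lerDl mulr_ge0 ?powR_ge0.
Qed.

Hypothesis Au : forall n x, cocycle f A n x \in unitmx.
Hypothesis ALam' : forall n x, mnorm (invmx (cocycle f A n x)) <= Lam.

(* The transfer map is an ultralimit of [cocycle f A i x_k], where the orbit of
   [x_k] is 1/k-dense and [i] is a time at which it is 1/k-close to the given point. *)
Lemma transfer_map (C K : R) : 0 <= C -> 0 <= K -> (forall x, mnorm (A x) <= K) ->
  compact [set: M] -> continuous f -> topologically_transitive f ->
  (forall x i j, mnorm (cocycle f A i x - cocycle f A j x) <=
    C * mdist (iter i f x) (iter j f x) `^ alpha) ->
  exists P : M -> 'M[R]_d, [/\ forall x, P x \in unitmx,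
    forall x, mnorm (invmx (P x)) <= 2 * Lam,
    forall x y, mnorm (P x - P y) <= C * 2 `^ alpha * mdist x y `^ alpha &
    forall x, P (f x) = A x *m P x].
Proof.
move=> C0 K0 AK cM cf ft CP.
have [[x0]|noM] := pselect (inhabited M); last first.
  by exists (fun=> 0); split=> x; case: noM.
have /choice[orb orbP] : forall k : nat, exists x, forall y, exists n,
    mdist (iter n f x) y < k.+1%:R^-1.
  by move=> k; apply: nearly_dense_orbit => //; rewrite invr_gt0.
have /choice[t tP] : forall ky : nat * M, exists n,
    mdist (iter n f (orb ky.1)) ky.2 < ky.1.+1%:R^-1 by case=> k y; exact: orbP.
have {}tP k y : mdist (iter (t (k, y)) f (orb k)) y < k.+1%:R^-1 := tP (k, y).
pose Q x k := cocycle f A (t (k, x)) (orb k).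
(* One ultrafilter serves all points, so approximations at several points can be realised at a
   common index [k]. *)
have [U [UU Uoo]] := ultraFilterLemma eventually_filter.
have small (e : R) : 0 < e -> U [set k | k.+1%:R^-1 < e].
  by move=> e0; apply: Uoo; have := @near_infty_natSinv_lt R (PosNum e0).
have /choice[P PP] : forall x, exists P, forall e, 0 < e -> U [set k | mnorm (Q x k - P) < e].
  by move=> x; apply: (ultra_limit_mx UU (b := Lam)) => k; exact: ALam.
have Pinv x : P x \in unitmx /\ mnorm (invmx (P x)) <= 2 * Lam.
  have e0 : 0 < (2 * (Lam + 1))^-1 by rewrite invr_gt0 mulr_gt0// ltr_wpDl.
  have [k Qk] := filter_ex (PP x _ e0).
  apply: (@unitmx_perturb R d (Q x k) _ _ (Au _ _) (ALam' _ _)).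
  move: Qk; rewrite /= mnormB -[_^-1]mul1r ltr_pdivlMr ?mulr_gt0 ?ltr_wpDl//.
  have := mnorm_ge0 (P x - Q x k); lra.
exists P; split=> [x|x|x y|x]; [by case: (Pinv x)|by case: (Pinv x)| |].
  have [->|/eqP xy] := pselect (x = y).
    by rewrite subrr mnorm0 !mulr_ge0 ?powR_ge0.
  have D0 : 0 < mdist x y by rewrite mdist_gt0.
  apply/ler_addgt0Pr => e e0.
  have e20 : 0 < e / 2 by rewrite divr_gt0.
  have D20 : 0 < mdist x y / 2 by rewrite divr_gt0.
  have [k [[xk yk] kD]] := filter_ex (filterI (filterI (PP x _ e20) (PP y _ e20)) (small _ D20)).
  have := mnorm_triangle (Q x k) (P x) (P y); have := mnorm_triangle (Q y k) (Q x k) (P y).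
  rewrite (mnormB (P x) (Q x k)); move: xk yk => /=.
  have : mnorm (Q x k - Q y k) <= C * 2 `^ alpha * mdist x y `^ alpha.
    apply: (le_trans (CP _ _ _)); rewrite -mulrA ler_wpM2l// -powRM//; last exact: ltW.
    apply: ge0_ler_powR; rewrite ?nnegrE ?mdist_ge0 ?mulr_ge0 ?mdist_ge0//; first exact: ltW.
    have := metric_triangle (iter (t (k, x)) f (orb k)) x (iter (t (k, y)) f (orb k)).
    have := metric_triangle x y (iter (t (k, y)) f (orb k)).
    rewrite (metric_sym y); have := tP k x; have := tP k y.
    by move: kD => /=; move: (k.+1%:R^-1) => q; lra.
  lra.
apply/eqP; rewrite -subr_eq0; apply/eqP/mnorm_le0.
(* [W] collects the coefficients of [w] in the four errors below: the limit at [f x], then [d1],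
   [d2] and [d3]. *)
pose W := 1 + C + L * Lam + K.
have W0 : 0 < W by rewrite !ltr_pwDl// ?addr_ge0 ?mulr_ge0 ?(ltW L0).
apply/ler_addgt0Pr => e e0; rewrite add0r.
pose w := e / W; have w0 : 0 < w by rewrite divr_gt0.
have [rho rho0 rhoP] := powR_small alpha0 w0.
have rho20 : 0 < rho / 2 by rewrite divr_gt0.
have /nbhs_ballP[eta /= eta0 etaP] := cf x _ (nbhsx_ballx (f x) _ rho20).
pose eta' := Num.min eta (rho / 2).
have eta'0 : 0 < eta' by rewrite lt_min eta0.
have [k [[xk yk] kD]] := filter_ex (filterI (filterI (PP x _ w0) (PP (f x) _ w0)) (small _ eta'0)).
move: kD; rewrite /= lt_min => /andP[keta krho].
set i := t (k, x); set j := t (k, f x).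
have xi := lt_trans (tP k x) krho; have xj := lt_trans (tP k (f x)) krho.
rewrite -/i -/j in xi xj.
have fxi : mdist (f x) (iter i.+1 f (orb k)) < rho / 2.
  have := etaP (iter i f (orb k)); rewrite /= !ballEmdist; apply => /=.
  by rewrite metric_sym; exact: lt_trans (tP k x) keta.
have d1 : mnorm (Q (f x) k - cocycle f A i.+1 (orb k)) <= C * w.
  apply: (le_trans (CP _ _ _)); rewrite ler_wpM2l//; apply: rhoP; rewrite mdist_ge0/=.
  have := metric_triangle (iter j f (orb k)) (f x) (iter i.+1 f (orb k)); lra.
have d2 : mnorm ((A (iter i f (orb k)) - A x) *m Q x k) <= L * w * Lam.
  rewrite (le_trans (ler_mnormM _ _))// ler_pM ?mnorm_ge0 ?ALam//.
  rewrite (le_trans (AL _ _))// ler_pM2l//; apply: rhoP; rewrite mdist_ge0/=; lra.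
have d3 : mnorm (A x *m (Q x k - P x)) <= K * w.
  by rewrite (le_trans (ler_mnormM _ _))// ler_pM ?mnorm_ge0// ltW.
have -> : P (f x) - A x *m P x = (P (f x) - Q (f x) k) + ((Q (f x) k - cocycle f A i.+1 (orb k))
    + ((A (iter i f (orb k)) - A x) *m Q x k + A x *m (Q x k - P x))).
  by rewrite mulmxBl mulmxBr /Q /=; rewrite !addrA !subrK.
have eW : e = w * W by rewrite /w divfK// gt_eqF.
rewrite (le_trans (ler_mnormD _ _))// mnormB.
move: yk => /= yk; have := ler_mnormD (Q (f x) k - cocycle f A i.+1 (orb k))
  ((A (iter i f (orb k)) - A x) *m Q x k + A x *m (Q x k - P x)).
have := ler_mnormD ((A (iter i f (orb k)) - A x) *m Q x k) (A x *m (Q x k - P x)).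
rewrite eW /W; lra.
Qed.

End Transfer.

Theorem corollary2p3 (R : realType) (M : metricType R) (f : M -> M)
    (d : nat) (alpha : R) (A : M -> 'M[R]_d) :
  compact [set: M] ->
  homeomorphism f ->
  topologically_transitive f ->
  anosov_closing f ->
  periodic_exponential_specification f ->
  (1 <= d)%N ->
  0 < alpha ->
  hoelder_map (fun B B' : 'M[R]_d => opnorm (B - B')) alpha A ->
  (forall (n : nat) (p : M), (1 <= n)%N -> iter n f p = p ->
    cocycle f A n p = 1%:M) ->
  exists P : M -> 'M[R]_d,
    [/\ forall x : M, P x \in unitmx,
        hoelder_map (@gldist R d) alpha P &
        forall x : M, A x = P (f x) *m invmx (P x)].
Proof.
move=> cM [g [fg gf cf _]] ft [C2 [eps0 [thc [C20 eps00 thc0 closing]]]]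
  [ths [ths0 spec]] _ alpha0 [LA [LA0 LAP]] A1.
have {}closing z n : mdist (iter n f z) z < eps0 ->
    exists2 p, iter n f p = p & forall j, (j <= n)%N ->
      mdist (iter j f z) (iter j f p)
        <= C2 * expR (- (thc * (minn j (n - j))%:R)) * mdist (iter n f z) z.
  by move=> /closing[p [pp pz _]]; exists p.
pose L := LA *+ (d * d) + 1.
have L0 : 0 < L by rewrite ltr_wpDl// mulrn_wge0// ltW.
have AL x y : mnorm (A x - A y) <= L * mdist x y `^ alpha.
  apply: (le_trans (mnorm_le_opnorm _)).
  apply: (@le_trans _ _ ((LA * mdist x y `^ alpha) *+ (d * d))).
    by rewrite lerMn2r LAP orbT.
  by rewrite -mulrnAl ler_wpM2r ?powR_ge0// lerDl.
have [K K0 AK] := hoelder_bounded_mx cM (ltW alpha0) (ltW L0) AL.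
have Aentry i j : bounded_hoelder alpha (fun x => A x i j).
  exists (K + L); first by rewrite addr_ge0// ltW.
  split=> [x|x y].
    by rewrite (le_trans (mnorm_entry _ _ _))// (le_trans (AK x))// lerDl ltW.
  have := mnorm_entry (A x - A y) i j; rewrite !mxE => /le_trans; apply.
  by rewrite (le_trans (AL x y))// ler_wpM2r ?powR_ge0// lerDr.
have [D D0 [detD detL]] := bounded_hoelder_det Aentry.
have D10 : 0 < D + 1 by rewrite ltr_wpDl.
have detL1 x y : `|\det (A x) - \det (A y)| <= (D + 1) * mdist x y `^ alpha.
  by rewrite (le_trans (detL x y))// ler_wpM2r ?powR_ge0// lerDl.
have detD1 x : `|\det (A x)| <= expR (D + 1).
  by have := expR_ge1Dx (D + 1); have := detD x; lra.
have det1 n p : (1 <= n)%N -> iter n f p = p -> \prod_(i < n) \det (A (iter i f p)) = 1.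
  by move=> n1 pp; rewrite -det_cocycle A1// det1.
(* A single rate meets both constraints: below the closing rate, and with its double below the
   specification rate. *)
pose eps := Num.min (thc * alpha) (ths * alpha) / 4.
have eps_gt0 : 0 < eps by rewrite divr_gt0// lt_min !mulr_gt0.
have eps_c : eps < thc * alpha.
  have : 0 < thc * alpha by exact: mulr_gt0.
  by rewrite /eps; case: (leP (thc * alpha) (ths * alpha)); lra.
have eps_s : 2 * eps < ths * alpha.
  have : 0 < ths * alpha by exact: mulr_gt0.
  by rewrite /eps; case: (leP (thc * alpha) (ths * alpha)); lra.
have gdet := scalar_subexponential alpha0 D10 D10 detL1 detD1 det1
  C20 eps00 eps_gt0 eps_c closing cM.
have [c c0 cdet] : exists2 c, 0 < c & forall x, c <= `|\det (A x)|.
  apply: (scalar_nonvanishing alpha0 D10 detL1 det1 gdet eps_s); first by exists g.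
  have [S [S0 specS]] := spec 1 ltr01.
  exists S; split=> // x n; have [p [pp px]] := specS x n.
  by exists p; split=> // j /px; rewrite mul1r.
have [Au [K' K'0 AK']] := bounded_invmx c0 Aentry cdet.
have [Lam Lam0 LamP] := invmx_cocycle_bounded alpha0 L0 ths0 AL A1 spec K0 K'0 AK Au AK'.
have LamA n x : mnorm (cocycle f A n x) <= Lam by case: (LamP n x).
have LamA' n x : mnorm (invmx (cocycle f A n x)) <= Lam by case: (LamP n x).
have [C C0 CP] := cocycle_orbit_hoelder alpha0 L0 thc0 Lam0 AL A1 LamA C20 eps00 closing.
have [P [Pu PLam PC Pf]] := transfer_map alpha0 L0 Lam0 AL LamA
  (cocycle_unit f Au) LamA' C0 K0 AK cM cf ft CP.
exists P; split=> // [|x]; last by rewrite Pf mulmxK.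
have [C4 C4E] : exists C4, C4 = C * 2 `^ alpha by eexists.
rewrite -C4E in PC; have C40 : 0 <= C4 by rewrite C4E mulr_ge0// powR_ge0.
exists (C4 + 2 * Lam * C4 * (2 * Lam) + 1); split.
  have : 0 <= 2 * Lam * C4 * (2 * Lam) by apply: mulr_ge0; rewrite !mulr_ge0.
  lra.
move=> x y; have D0' := powR_ge0 (mdist x y) alpha.
have invB : mnorm (invmx (P x) - invmx (P y)) <=
    2 * Lam * (C4 * mdist x y `^ alpha) * (2 * Lam).
  (* The difference of inverses is expressed through [P y - P x], so the uniform bound on
     [invmx (P x)] transfers the Hoelder estimate. *)
  have -> : invmx (P x) - invmx (P y) = invmx (P x) *m (P y - P x) *m invmx (P y).
    by rewrite mulmxBr mulmxBl mulmxK// mulVmx// mul1mx.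
  rewrite (le_trans (ler_mnormM _ _))// ler_pM ?mnorm_ge0//.
  by rewrite (le_trans (ler_mnormM _ _))// ler_pM ?mnorm_ge0// mnormB PC.
apply: (le_trans (lerD (opnorm_le_mnorm _) (opnorm_le_mnorm _))).
by have := PC x y; lra.
Qed.
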